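(* Let $\mathscr{A}$ and $\mathscr{B}$ be two cross-intersecting Sperner families on $\mathbb{N}_n$, where $n\ge 4$ is an even integer. Then $|\mathscr{A}|+|\mathscr{B}|=\binom{n}{n/2}+\binom{n}{(n/2)+1}-1$ if and only if (i) $\mathscr{A}=\binom{\mathbb{N}_n}{n/2}$, $\mathscr{B}\subset\binom{\mathbb{N}_n}{(n/2)+1}$ and $|\mathscr{B}|=\binom{n}{(n/2)+1}-1$, or (ii) $\mathscr{A}\subset\binom{\mathbb{N}_n}{n/2}$, $|\mathscr{A}|=\binom{n}{n/2}-1$, and $\mathscr{B}=\binom{\mathbb{N}_n}{(n/2)+1}$.
   Context: For a positive integer $n$, $\mathbb{N}_n=\{1,2,\ldots,n\}$, and for $0\le k\le n$, $\binom{\mathbb{N}_n}{k}$ denotes the collection of all $k$-element subsets of $\mathbb{N}_n$. A Sperner family (or antichain) on $\mathbb{N}_n$ is a collection $\mathscr{F}$ of subsets of $\mathbb{N}_n$ such that $X\not\subseteq Y$ for all distinct $X,Y\in\mathscr{F}$. Two families $\mathscr{A},\mathscr{B}\subseteq 2^{\mathbb{N}_n}$ (where $2^{\mathbb{N}_n}$ is the power set of $\mathbb{N}_n$) are cross-intersecting if $A\cap B\neq\emptyset$ for all $A\in\mathscr{A}$ and all $B\in\mathscr{B}$.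
   Formalization: The characterization is proved up to interchanging the two families: equality holds iff (i) or (ii) holds for (A,B) or for (B,A); as literally stated it fails for A the (n/2+1)-layer minus one set and B the n/2-layer. *)

(* Defs.v *)
From mathcomp Require Import all_boot.
Set Implicit Arguments.
Unset Strict Implicit.
Unset Printing Implicit Defensive.

(* The ground set {1, ..., n} is represented by 'I_n = {0, ..., n-1}. *)

Definition layer (n k : nat) : {set {set 'I_n}} := [set X : {set 'I_n} | #|X| == k].

Definition sperner (n : nat) (F : {set {set 'I_n}}) : Prop :=
  forall X Y : {set 'I_n}, X \in F -> Y \in F -> X != Y -> ~~ (X \subset Y).

Definition cross_intersecting (n : nat) (A B : {set {set 'I_n}}) : Prop :=
  forall X Y : {set 'I_n}, X \in A -> Y \in B -> X :&: Y != set0.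

Definition extremal_i (n : nat) (A B : {set {set 'I_n}}) : Prop :=
  [/\ A = layer n n./2,
      B \proper layer n n./2.+1
    & #|B| = 'C(n, n./2.+1) - 1].

Definition extremal_ii (n : nat) (A B : {set {set 'I_n}}) : Prop :=
  [/\ A \proper layer n n./2,
      #|A| = 'C(n, n./2) - 1
    & B = layer n n./2.+1].

(* Main.v *)
(* Let n = 2k, N = 'C(n, k) and M = 'C(n, k.+1), so that k N = (k + 1) M. Given an
   antichain F, let P be the k-shadow of its members larger than k, and Q the
   k-shadow of the complements of its members smaller than k. The middle part of
   F, P and the complements of Q are disjoint in the middle layer, and the local
   LYM inequality gives (k + 1) times the number of non-middle members at most
   k (|P| + |Q|). A shadow that is neither empty nor the whole layer costs an
   additional k, because the Johnson graph is connected: exchanging one element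
   leads out of P, and produces k sets of size k + 1 above P that have a
   k-subset outside P.
   So every nontrivial shadow and every middle set left unused wastes k. When
   |A| + |B| = N + M - 1 at most one unit can be wasted in total, so one of
   the two families wastes nothing, which forces it to be the middle layer or to
   lie strictly on one side of it. *)

Require Import Defs.
From mathcomp Require Import all_boot zify.
Set Implicit Arguments.
Unset Strict Implicit.
Unset Printing Implicit Defensive.

(** * Shadows, complements and the local LYM inequality *)

Definition shadow n j (G : {set {set 'I_n}}) : {set {set 'I_n}} :=
  [set X in layer n j | [exists Y in G, X \subset Y]].

Definition compls n (G : {set {set 'I_n}}) : {set {set 'I_n}} :=
  [set X | ~: X \in G].

Definition proper_part n k (P : {set {set 'I_n}}) : bool :=
  (P != set0) && (P != layer n k).

Lemma layerE n k (X : {set 'I_n}) : (X \in layer n k) = (#|X| == k).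
Proof. by rewrite inE. Qed.

Lemma card_layer n k : #|layer n k| = 'C(n, k).
Proof. by rewrite /layer card_draws card_ord. Qed.

Lemma shadowP n j (G : {set {set 'I_n}}) (X : {set 'I_n}) :
  reflect (#|X| = j /\ exists2 Y, Y \in G & X \subset Y) (X \in shadow j G).
Proof.
rewrite inE layerE; apply: (iffP andP) => [[/eqP cX /exists_inP H]|[-> H]];
  first by split.
by split=> //; apply/exists_inP.
Qed.

Lemma shadow_sub n j (G : {set {set 'I_n}}) : shadow j G \subset layer n j.
Proof. by apply/subsetP=> X /shadowP[cX _]; rewrite layerE cX. Qed.

Lemma complsK n : involutive (@compls n).
Proof. by move=> G; apply/setP=> X; rewrite !inE setCK. Qed.

Lemma card_compls n (G : {set {set 'I_n}}) : #|compls G| = #|G|.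
Proof.
rewrite -[RHS](card_imset _ (@setC_inj 'I_n)); congr #|pred_of_set _|.
apply/setP=> X; rewrite inE; apply/idP/imsetP => [H|[Y H ->]].
  by exists (~: X); rewrite ?setCK.
by rewrite setCK.
Qed.

Lemma sperner_sub n (F G : {set {set 'I_n}}) :
  G \subset F -> sperner F -> sperner G.
Proof. by move=> /subsetP GF sF X Y /GF XF /GF YF; apply: sF. Qed.

Lemma sperner_compls n (F : {set {set 'I_n}}) : sperner F -> sperner (compls F).
Proof.
move=> sF X Y; rewrite !inE => XF YF XY; rewrite -setCS; apply: sF => //.
by apply: contra XY => /eqP/setC_inj ->.
Qed.

Lemma exists_subset_card n (Y : {set 'I_n}) j :
  j <= #|Y| -> exists2 X : {set 'I_n}, X \subset Y & #|X| = j.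
Proof.
move=> le_j; have: 0 < #|[set X : {set 'I_n} | (X \subset Y) && (#|X| == j)]|.
  by rewrite cards_draws bin_gt0.
by case/card_gt0P=> X; rewrite inE => /andP[sX /eqP cX]; exists X.
Qed.

(* Double counting of the pairs [Z \subset V] with [#|V| = j.+1] and [Z] in the
   shadow; [R] records some of the pairs with [V \notin G]. *)
Lemma local_lym n j (G R : {set {set 'I_n}}) :
    G \subset layer n j.+1 -> R \subset layer n j.+1 -> [disjoint G & R] ->
    (forall V, V \in R -> exists2 Z, Z \in shadow j G & Z \subset V) ->
  j.+1 * #|G| + #|R| <= (n - j) * #|shadow j G|.
Proof.
move=> Gl Rl dGR hR; set P := shadow j G.
pose inc (V : {set 'I_n}) := #|[set Z in P | Z \subset V]|.
have upper : \sum_(V in layer n j.+1) inc V <= (n - j) * #|P|.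
  under eq_bigr => V _ do rewrite /inc -sum1dep_card.
  rewrite (exchange_big_dep (mem P)) /=; last by move=> V Z _ /andP[].
  rewrite mulnC -sum_nat_const; apply: leq_sum => Z PZ.
  rewrite sum1dep_card.
  have /shadowP[cZ _] := PZ.
  have <- : #|~: Z| = n - j by rewrite cardsCs setCK cZ card_ord.
  apply: leq_trans (leq_imset_card (fun c => c |: Z) (~: Z)).
  apply/subset_leq_card/subsetP=> V; rewrite inE layerE => /and3P[/eqP cV _ sZV].
  have : #|V :\: Z| == 1 by rewrite cardsD (setIidPr sZV) cV cZ subSnn.
  case/cards1P=> c cE; apply/imsetP; exists c.
    have: c \in V :\: Z by rewrite cE set11.
    by rewrite !inE => /andP[].
  rewrite -cE; apply/setP=> x; rewrite !inE.
  by case: (boolP (x \in Z)) => [/(subsetP sZV) ->|]; rewrite ?orbF.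
apply: leq_trans upper.
(* A member of [G] contributes all its j + 1 subsets of size j; a member of [R] contributes at least
   one pair. *)
rewrite (big_setID G) /= (setIidPr Gl); apply: leq_add.
  rewrite mulnC -sum_nat_const; apply: leq_sum => V GV.
  have := subsetP Gl _ GV; rewrite layerE => /eqP cV.
  rewrite -(binSn j) -cV -cards_draws; apply/subset_leq_card/subsetP=> Z.
  rewrite !inE => /andP[sZ cZ]; rewrite cZ sZ /= andbT.
  by apply/exists_inP; exists V.
rewrite -sum1_card [X in _ <= X](big_setID R) /= (setIidPr _); last first.
  by rewrite subsetD Rl disjoint_sym.
apply: leq_trans (leq_addr _ _); apply: leq_sum => V RV.
have [Z PZ sZ] := hR _ RV; apply/card_gt0P; exists Z.
by rewrite inE PZ.
Qed.

(** Adding to [X] one element of [Y] outside [X] gives the intermediate set. This makes local LYM,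
    which needs a uniform family, applicable to members of mixed sizes. *)
Lemma shadow_shadow n j (G : {set {set 'I_n}}) :
  (forall X, X \in G -> j < #|X|) -> shadow j G = shadow j (shadow j.+1 G).
Proof.
move=> szG; apply/setP=> X; apply/shadowP/shadowP => [[cX [Y YG sXY]]|].
  split=> //; have jY := szG _ YG.
  have : 0 < #|Y :\: X| by rewrite cardsD (setIidPr sXY) cX subn_gt0.
  case/card_gt0P=> c; rewrite inE => /andP[cNX cY].
  exists (c |: X); last exact: subsetUr.
  apply/shadowP; split; first by rewrite cardsU1 cNX cX.
  by exists Y; rewrite // subUset sub1set cY.
case=> cX [V /shadowP[_ [Y YG sVY]] sXV]; split=> //; exists Y => //.
exact: subset_trans sVY.
Qed.

(** Members of size j are in the shadow, and by the antichain property they avoid the shadow of the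
    larger members. The larger ones are first pushed down to level j + 1 by induction; the last step
    down is local LYM with n - j <= j + 1. *)
Lemma leq_card_shadow n j (G : {set {set 'I_n}}) :
    n <= j.*2.+1 -> sperner G -> (forall X, X \in G -> j <= #|X|) ->
  #|G| <= #|shadow j G|.
Proof.
move=> nj; have [m] := ubnP (n - j); elim: m j nj G => // m IHm j nj G lt_m sG szG.
pose G1 := G :&: layer n j; pose G2 := G :\: layer n j.
have sG2 : sperner G2 by apply: sperner_sub sG; apply: subsetDl.
have szG2 X : X \in G2 -> j < #|X|.
  rewrite inE layerE => /andP[cX XG]; have := szG _ XG.
  by rewrite leq_eqVlt eq_sym (negPf cX).
have disj : [disjoint G1 & shadow j G2].
  rewrite disjoint_subset; apply/subsetP=> X /setIP[XG cX]; rewrite inE.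
  apply/negP=> /shadowP[_ [Y /setDP[YG cY] sXY]].
  have /(sG _ _ XG YG)/negP : X != Y by apply: contraNneq cY => <-.
  by apply.
have -> : #|G| = #|G1| + #|G2| by rewrite cardsID.
have leS : #|G1| + #|shadow j G2| <= #|shadow j G|.
  rewrite -(leq_card_setU G1 (shadow j G2)).2 in disj.
  rewrite -(eqP disj); apply/subset_leq_card/subsetP=> X /setUP[/setIP[XG]|].
    by rewrite layerE => /eqP cX; apply/shadowP; split=> //; exists X.
  case/shadowP=> cX [Y /setDP[YG _] sXY]; apply/shadowP; split=> //.
  by exists Y.
apply: leq_trans leS; rewrite leq_add2l.
(* When n <= j the measure n - j cannot decrease, but then no set has more than j elements. *)
case: (ltnP j n) => [lt_jn | le_nj]; last first.
  suff -> : G2 = set0 by rewrite cards0.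
  apply/setP=> X; rewrite [RHS]inE; apply/negP=> /szG2; rewrite ltnNge.
  by rewrite (leq_trans _ le_nj) // -[X in _ <= X]card_ord max_card.
have IH : #|G2| <= #|shadow j.+1 G2| by apply: IHm => //; lia.
have := @local_lym n j (shadow j.+1 G2) set0 (shadow_sub _ _) (sub0set _) _ _.
rewrite -shadow_shadow // cards0 addn0 => L.
have {L} : j.+1 * #|shadow j.+1 G2| <= (n - j) * #|shadow j G2|.
  by apply: L; [rewrite disjoint_sym disjoints_subset sub0set | move=> V; rewrite inE].
nia.
Qed.

(** * Exchanges and the extra cost of a nontrivial shadow *)

Lemma card_exchange n (Z : {set 'I_n}) a b :
  a \in Z -> b \notin Z -> #|b |: (Z :\ a)| = #|Z|.
Proof.
by move=> aZ bZ; rewrite cardsU1 (cardsD1 a Z) aZ !inE negb_and bZ orbT.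
Qed.

(** Fix [X] in [P] and [Z] outside. Exchanging an element of [Z :\: X] for one of [X :\: Z] either
    enters [P] or gives another set outside [P] that is closer to [X]. *)
Lemma exists_exchange n k (P : {set {set 'I_n}}) :
    P \subset layer n k -> proper_part k P ->
  exists (Z : {set 'I_n}) a b, [/\ #|Z| = k, Z \notin P, a \in Z, b \notin Z
                  & b |: (Z :\ a) \in P].
Proof.
move=> Pl /andP[/set0Pn[X XP] P_l].
have [Z] : exists Z, Z \in layer n k :\: P.
  by apply/set0Pn; rewrite setD_eq0; apply: contra P_l => lP; rewrite eqEsubset Pl.
rewrite inE layerE => /andP[ZP /eqP cZ].
have cX : #|X| = k by have := subsetP Pl _ XP; rewrite layerE => /eqP.
have [m] := ubnP #|Z :\: X|; elim: m Z ZP cZ => // m IHm Z ZP cZ lt_m.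
have eqD : #|Z :\: X| = #|X :\: Z| by rewrite !cardsD cX cZ setIC.
have ZX : 0 < #|Z :\: X|.
  rewrite lt0n cards_eq0 setD_eq0; apply: contra ZP => sZX.
  suff -> : Z = X by [].
  by apply/eqP; rewrite eqEcard sZX cX cZ leqnn.
have XZ := ZX; rewrite eqD in XZ.
have [a /[dup] aD /setDP[aZ aX]] := card_gt0P ZX.
have [b /setDP[bX bZ]] := card_gt0P XZ.
have [WP|WP] := boolP (b |: (Z :\ a) \in P); first by exists Z, a, b.
apply: (IHm _ WP); first by rewrite card_exchange.
rewrite -ltnS; apply: leq_trans lt_m; rewrite ltnS (cardsD1 a (Z :\: X)) aD ltnS.
apply/subset_leq_card/subsetP=> x; rewrite !inE => /andP[xX].
case/orP=> [/eqP xb|/andP[-> ->]]; last by rewrite xX.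
by rewrite xb bX in xX.
Qed.

(** Local LYM is applied to [T], which has the same j-shadow as [G] and at least as many members. If
    that shadow is nontrivial, an exchange supplies n - j sets for the role of [R]. *)
Lemma shadow_slack n j (G : {set {set 'I_n}}) :
    n <= j.*2.+1 -> sperner G -> (forall X, X \in G -> j < #|X|) ->
  j.+1 * #|G| + (n - j) * proper_part j (shadow j G) <= (n - j) * #|shadow j G|.
Proof.
move=> nj sG szG; set P := shadow j G; set T := shadow j.+1 G.
have leGT : #|G| <= #|T| by apply: leq_card_shadow; rewrite // doubleS; lia.
have PE : P = shadow j T by apply: shadow_shadow.
have lo (R : {set {set 'I_n}}) : R \subset layer n j.+1 -> [disjoint T & R] ->
    (forall V, V \in R -> exists2 Z, Z \in P & Z \subset V) ->
    j.+1 * #|G| + #|R| <= (n - j) * #|P|.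
  move=> Rl dR hR.
  have := local_lym (shadow_sub j.+1 G) Rl dR; rewrite -/T -PE => /(_ hR).
  by apply: leq_trans; rewrite leq_add2r leq_mul2l leGT orbT.
case pP: (proper_part j P); last first.
  rewrite muln0 -(cards0 {set 'I_n}); apply: lo; first exact: sub0set.
    by rewrite disjoint_sym disjoints_subset sub0set.
  by move=> V; rewrite inE.
have [Z [a [b [cZ ZP aZ bZ bP]]]] := exists_exchange (shadow_sub _ _) pP.
(* Each [f c] contains a [j]-set outside [P], so it is not in [T]. *)
pose f c := c |: (if c |: (Z :\ a) \in P then Z else b |: (Z :\ a)).
have cfE : #|~: Z| = n - j by rewrite cardsCs setCK cZ card_ord.
have ab : a != b by apply: contraNneq bZ => <-.
have cN c : c \notin Z -> c |: (Z :\ a) \notin P -> c \notin b |: (Z :\ a).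
  move=> cZ' cP; rewrite !inE (negPf cZ') andbF orbF.
  by apply: contraNneq cP => ->.
have TP (V W : {set 'I_n}) : V \in T -> W \subset V -> #|W| = j -> W \in P.
  by move=> VT WV cW; rewrite PE; apply/shadowP; split; last exists V.
(* The two forms of [f c] are told apart by [a], which belongs only to the first. *)
have f_inj : {in ~: Z &, injective f}.
  move=> c c'; rewrite !inE => cZ' c'Z; rewrite /f.
  have [cP|cP] := boolP (c |: (Z :\ a) \in P);
    have [c'P|c'P] := boolP (c' |: (Z :\ a) \in P) => E.
  - have := setU11 c Z; rewrite E !inE (negPf cZ') orbF => /eqP //.
  - have /setU1P[] : a \in c' |: (b |: (Z :\ a)) by rewrite -E inE aZ orbT.
      by move=> ac'; rewrite -ac' aZ in c'Z.
    by rewrite !inE eqxx (negPf ab).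
  - have /setU1P[] : a \in c |: (b |: (Z :\ a)) by rewrite E inE aZ orbT.
      by move=> ac; rewrite -ac aZ in cZ'.
    by rewrite !inE eqxx (negPf ab).
  - have := setU11 c (b |: (Z :\ a)); rewrite E => /setU1P[] // cb.
    by have := cN _ cZ' cP; rewrite cb.
rewrite muln1 -{1}cfE -(card_in_imset f_inj); apply: lo.
- apply/subsetP=> _ /imsetP[c cZ' ->]; rewrite inE in cZ'.
  rewrite layerE /f; case: ifPn => cP; first by rewrite cardsU1 cZ' cZ.
  by rewrite cardsU1 cN // card_exchange // cZ.
- rewrite disjoint_sym disjoint_subset; apply/subsetP=> _ /imsetP[c cZ' ->].
  rewrite inE in cZ'; rewrite inE /f; case: ifPn => cP; apply/negP=> VT.
    by rewrite (TP _ _ VT (subsetUr _ _) cZ) in ZP.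
  case/negP: cP; apply: TP VT _ _; last by rewrite card_exchange.
  by rewrite setUS // subsetUr.
move=> _ /imsetP[c cZ' ->]; rewrite /f; case: ifPn => cP.
  by exists (c |: (Z :\ a)); rewrite // setUS // subsetDl.
by exists (b |: (Z :\ a)); rewrite // subsetUr.
Qed.

(** * An antichain around the middle layer, and its waste *)

Definition above n k (F : {set {set 'I_n}}) : {set {set 'I_n}} :=
  [set X in F | k < #|X|].

Lemma card_setC_ord n (X : {set 'I_n}) : #|~: X| = n - #|X|.
Proof. by rewrite cardsCs setCK card_ord. Qed.

(** Since n = 2k, complementation swaps the sizes below and above k, so the last term counts the
    members smaller than k. *)
Lemma card_above n k (F : {set {set 'I_n}}) : n = k.*2 ->
  #|F| = #|F :&: layer n k| + #|above k F| + #|above k (compls F)|.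
Proof.
move=> nk; rewrite -(card_compls (above k (compls F))).
rewrite -(cardsID (layer n k) F) -addnA; congr (_ + _).
rewrite -(cardsID (above k F) (F :\: _)); congr addn; apply: eq_card => X.
  rewrite !inE; case: (X \in F); rewrite ?andbF //= andbT.
  by case: ltngtP.
rewrite !inE setCK card_setC_ord.
case: (X \in F); rewrite ?andbF //= andbT -leqNgt.
have : #|X| <= n by rewrite -[X in _ <= X]card_ord max_card.
by move=> Xn; apply/idP/idP; lia.
Qed.

Lemma sperner_above n k (F : {set {set 'I_n}}) :
  sperner F -> sperner (above k F).
Proof. by apply: sperner_sub; apply/subsetP=> X; rewrite inE => /andP[]. Qed.

Lemma above_gt n k (F : {set {set 'I_n}}) X : X \in above k F -> k < #|X|.
Proof. by rewrite inE => /andP[]. Qed.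

Lemma sperner_disjoint_shadow n k (F : {set {set 'I_n}}) :
  sperner F -> [disjoint F & shadow k (above k F)].
Proof.
move=> sF; rewrite disjoint_subset; apply/subsetP=> X XF; rewrite inE.
apply/negP=> /shadowP[cX [Y]]; rewrite inE => /andP[YF kY] sXY.
have /(sF _ _ XF YF)/negP : X != Y by apply: contraTneq kY => <-; rewrite cX ltnn.
by apply.
Qed.

Lemma card_shadows_le n k (F : {set {set 'I_n}}) : n = k.*2 -> sperner F ->
  #|F :&: layer n k| + #|shadow k (above k F)|
    + #|shadow k (above k (compls F))| <= 'C(n, k).
Proof.
move=> nk sF; set P := shadow k _; set Q := shadow k _.
have dP : [disjoint F & P] by apply: sperner_disjoint_shadow.
have dQ : [disjoint F & compls Q].
  have := sperner_disjoint_shadow k (sperner_compls sF).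
  rewrite !disjoint_subset => /subsetP d; apply/subsetP=> X XF.
  by have := d (~: X); rewrite !inE setCK => /(_ XF).
(* A common set would lie between a member smaller than k and a member larger than k. *)
have dPQ : [disjoint P & compls Q].
  rewrite disjoint_subset; apply/subsetP=> X /shadowP[cX [Y]]; rewrite !inE.
  case/andP=> YF kY sXY; apply/negP=> /andP[_ /exists_inP[Z]].
  rewrite !inE => /andP[ZF kZ]; rewrite subCset => sZX.
  have : ~: Z \subset Y := subset_trans sZX sXY.
  apply/negP; apply: sF => //; apply: contraTneq kY => <-.
  by rewrite -leqNgt card_setC_ord; lia.
rewrite -card_layer -(card_compls Q).
have -> : #|F :&: layer n k| + #|P| = #|(F :&: layer n k) :|: P|.
  apply/esym/eqP; rewrite (leq_card_setU _ _).2.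
  by apply: disjointWl dP; apply: subsetIl.
have -> : #|F :&: layer n k :|: P| + #|compls Q|
          = #|(F :&: layer n k :|: P) :|: compls Q|.
  apply/esym/eqP; rewrite (leq_card_setU _ _).2.
  rewrite -setI_eq0 setIUl setU_eq0 !setI_eq0 dPQ andbT.
  by apply: disjointWl dQ; apply: subsetIl.
apply/subset_leq_card; rewrite !subUset subsetIr shadow_sub /=.
apply/subsetP=> X; rewrite inE => /(subsetP (shadow_sub _ _)).
have : #|X| <= n by rewrite -[X in _ <= X]card_ord max_card.
by rewrite !layerE card_setC_ord => Xn /eqP; lia.
Qed.

Definition waste n k (F : {set {set 'I_n}}) : nat :=
  let P := shadow k (above k F) in let Q := shadow k (above k (compls F)) in
  proper_part k P + proper_part k Q
    + ('C(n, k) - (#|F :&: layer n k| + #|P| + #|Q|)).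

Lemma waste_bound n k (F : {set {set 'I_n}}) : n = k.*2 -> sperner F ->
  k * #|F :&: layer n k| + k.+1 * (#|above k F| + #|above k (compls F)|)
    + k * waste k F <= k * 'C(n, k).
Proof.
move=> nk sF; rewrite /waste /=; have := card_shadows_le nk sF.
have nk1 : n <= k.*2.+1 by rewrite nk.
have nkk : n - k = k by lia.
have := shadow_slack nk1 (@sperner_above _ k _ sF) (@above_gt _ _ _).
have := shadow_slack nk1 (@sperner_above _ k _ (sperner_compls sF)) (@above_gt _ _ _).
rewrite !nkk; set p := nat_of_bool _; set q := nat_of_bool _.
move: #|_ :&: _| #|shadow _ _| #|shadow _ _| #|above _ _| #|above _ _| p q 'C(n, k).
move=> a P Q U V p q N HQ HP HN; nia.
Qed.

Lemma card_shadow_above n k (F : {set {set 'I_n}}) :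
  n <= k.*2.+1 -> sperner F -> #|above k F| <= #|shadow k (above k F)|.
Proof.
move=> nk sF; apply: leq_card_shadow => // [|X]; first exact: sperner_above.
by move/above_gt/ltnW.
Qed.

(** Each shadow is empty or full. A full one leaves no room in the middle layer for the other parts;
    if both are empty, [F] has only middle sets and uses all of them. The third case keeps the full
    shadow so that cross-intersection can refute it later. *)
Lemma zero_waste n k (F : {set {set 'I_n}}) :
    n = k.*2 -> sperner F -> waste k F = 0 ->
  [\/ F = layer n k,
      F = above k F
    | compls F = above k (compls F) /\ shadow k (above k (compls F)) = layer n k].
Proof.
move=> nk sF /eqP; rewrite /waste /= !addn_eq0 -andbA => /and3P[pP pQ gap].
have nk1 : n <= k.*2.+1 by rewrite nk.
have leN := card_shadows_le nk sF.
have PU := card_shadow_above nk1 sF.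
have QW := card_shadow_above nk1 (sperner_compls sF).
have cF := card_above F nk; have cN := card_layer n k.
have sub (G : {set {set 'I_n}}) : above k G \subset G.
  by apply/subsetP=> X; rewrite inE => /andP[].
have pure (P : {set {set 'I_n}}) :
    proper_part k P == 0 :> nat -> P = set0 \/ P = layer n k.
  rewrite eqb0 /proper_part negb_and !negbK.
  by case/orP => /eqP; [left | right].
have [P0|P1] := pure _ pP; last first.
  apply: Or32; apply/esym/eqP; rewrite eqEcard sub.
  move: leN; rewrite P1 cN; lia.
have [Q0|Q1] := pure _ pQ; last first.
  apply: Or33; split=> //; apply/esym/eqP; rewrite eqEcard sub card_compls.
  move: leN; rewrite Q1 cN; lia.
apply: Or31; rewrite P0 Q0 !cards0 in leN PU QW gap.
have /setIidPl Fl : F \subset layer n k.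
  by apply/setIidPl/eqP; rewrite eqEcard subsetIl; lia.
rewrite subn_eq0 !addn0 in gap; apply/eqP.
by rewrite eqEcard -{1}Fl subsetIr cN cF -!addnA (leq_trans gap) ?leq_addr.
Qed.

(** * Binomial estimates and large antichains above the middle *)

Lemma mid_bin k : k * 'C(k.*2, k) = k.+1 * 'C(k.*2, k.+1).
Proof. by rewrite mul_bin_left -addnn addnK. Qed.

(** Compare with C(k + 2, 2) = (k + 2)(k + 1)/2, where k + 2 >= 4. *)
Lemma leq_mid_bin k : 1 < k -> k.+1.*2 <= 'C(k.*2, k).
Proof.
move=> k1; apply: leq_trans (_ : 'C(k.+2, k) <= _); last by apply: leq_bin2l; lia.
have := @bin_sub k.+2 2 isT; rewrite subSS subSS subn0 => ->.
by rewrite bin2 geq_half_double -pred_Sn; nia.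
Qed.

(** If [G] is nonempty, its shadow [P] at level k + 1 has at least k + 2 sets, and (k + 2)|G| <= (k
    - 1)|P|. So replacing [G] by [P] gains at least two sets, while [F] is at most one short of the
    layer. *)
Lemma sperner_above_layer n k (F : {set {set 'I_n}}) :
    n = k.*2 -> sperner F -> (forall X, X \in F -> k < #|X|) ->
    'C(n, k.+1) <= #|F|.+1 ->
  F \subset layer n k.+1.
Proof.
move=> nk sF szF leF; set G := above k.+1 F.
have nk1 : n <= k.+1.*2.+1 by rewrite nk; lia.
have sG : sperner G by apply: sperner_above.
have := shadow_slack nk1 sG (@above_gt _ _ _).
set P := shadow k.+1 G => slack.
have -> : (F \subset layer n k.+1) = (G == set0).
  apply/subsetP/eqP => [Fl|G0 X XF].
    apply/setP=> X; rewrite !inE; apply/negP=> /andP[XF].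
    by have := Fl _ XF; rewrite layerE => /eqP ->; rewrite ltnn.
  have := szF _ XF; rewrite layerE leq_eqVlt eq_sym => /orP[] // kX.
  by have : X \in G; [rewrite inE XF | rewrite G0 inE].
apply: contraT => /set0Pn[Y YG].
have leP : k.+2 <= #|P|.
  have kY := above_gt YG.
  apply: leq_trans (_ : 'C(#|Y|, k.+1) <= _).
    by rewrite -[X in X <= _]binSn; apply: leq_bin2l.
  rewrite -cards_draws; apply/subset_leq_card/subsetP=> Z.
  by rewrite inE => /andP[sZ /eqP cZ]; apply/shadowP; split=> //; exists Y.
have cF : #|F| = #|F :&: layer n k.+1| + #|G|.
  rewrite -(cardsID (layer n k.+1) F); congr addn; apply: eq_card => X.
  rewrite !inE; case: (boolP (X \in F)) => [/szF kX|_]; last by rewrite andbF.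
  by rewrite andbT (ltn_neqAle k.+1) kX andbT eq_sym.
have leM : #|F :&: layer n k.+1| + #|P| <= 'C(n, k.+1).
  rewrite -card_layer.
  have /(disjointWl (subsetIl F (layer n k.+1))) dP :=
    sperner_disjoint_shadow k.+1 sF.
  rewrite -(leq_card_setU _ _).2 in dP; rewrite -(eqP dP).
  by apply/subset_leq_card; rewrite subUset subsetIr shadow_sub.
have nkE : n - k.+1 = k.-1 by lia.
rewrite nkE in slack; nia.
Qed.

(** * Cross-intersecting pairs *)

Definition extremal n (A B : {set {set 'I_n}}) : Prop :=
  (extremal_i A B \/ extremal_ii A B) \/ (extremal_i B A \/ extremal_ii B A).

Lemma extremalC n (A B : {set {set 'I_n}}) : extremal A B -> extremal B A.
Proof. by case; [right | left]. Qed.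

Lemma cross_intersectingC n (A B : {set {set 'I_n}}) :
  cross_intersecting A B -> cross_intersecting B A.
Proof. by move=> cAB X Y XB YA; rewrite setIC; apply: cAB. Qed.

Lemma full_layer_extremal n k (B : {set {set 'I_n}}) :
    1 < k -> n = k.*2 -> sperner B -> cross_intersecting (layer n k) B ->
    #|B| = 'C(n, k.+1) - 1 ->
  extremal_i (layer n k) B.
Proof.
move=> k1 nk sB cB BE; have kE : n./2 = k by rewrite nk doubleK.
have M0 : 0 < 'C(n, k.+1) by rewrite bin_gt0; lia.
(* Otherwise the complement of [X] contains a middle set, which is disjoint from [X]. *)
have szB X : X \in B -> k < #|X|.
  move=> XB; rewrite ltnNge; apply/negP=> Xk.
  have [|Z sZ cZ] := @exists_subset_card n (~: X) k.
    by rewrite card_setC_ord; lia.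
  have /cB/(_ XB)/negP : Z \in layer n k by rewrite layerE cZ.
  by apply; rewrite setI_eq0 disjoints_subset.
have Bl : B \subset layer n k.+1 by apply: sperner_above_layer => //; lia.
split; rewrite kE //; rewrite properEcard Bl card_layer BE; lia.
Qed.

(** No member of [A] is the complement of a member of [B], so complementing the middle part of [B]
    makes it disjoint from that of [A]. *)
Lemma card_mid_layer_le n k (A B : {set {set 'I_n}}) :
    n = k.*2 -> cross_intersecting A B ->
  #|A :&: layer n k| + #|B :&: layer n k| <= 'C(n, k).
Proof.
move=> nk cAB; rewrite -(card_compls (B :&: _)) -card_layer.
have d : [disjoint A :&: layer n k & compls (B :&: layer n k)].
  rewrite disjoint_subset; apply/subsetP=> X /setIP[XA _].
  rewrite !inE; apply/negP=> /andP[XB _].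
  by have := cAB _ _ XA XB; rewrite setICr eqxx.
rewrite -(leq_card_setU _ _).2 in d; rewrite -(eqP d).
apply/subset_leq_card; rewrite subUset subsetIr; apply/subsetP=> X.
rewrite !inE card_setC_ord => /andP[_ /eqP].
have : #|X| <= n by rewrite -[X in _ <= X]card_ord max_card.
lia.
Qed.

Lemma zero_waste_extremal n k (A B : {set {set 'I_n}}) :
    1 < k -> n = k.*2 -> sperner A -> sperner B -> cross_intersecting A B ->
    #|A| + #|B| = 'C(n, k) + 'C(n, k.+1) - 1 -> waste k A = 0 ->
  extremal A B.
Proof.
move=> k1 nk sA sB cAB sumAB wA0.
have kE : n./2 = k by rewrite nk doubleK.
have NM : k * 'C(n, k) = k.+1 * 'C(n, k.+1) by rewrite nk mid_bin.
have Nk : k.+1.*2 <= 'C(n, k) by rewrite nk leq_mid_bin.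
have cB := card_above B nk.
have wB := waste_bound nk sB.
have wA := waste_bound nk sA.
have cA := card_above A nk.
have cN := card_layer n k; have cM := card_layer n k.+1.
(* If [A] is not the middle layer, it lies strictly on one side of it, hence is
   no larger than the next layer and [B] fills the middle layer up to one set. *)
have main : A :&: layer n k = set0 -> extremal A B.
  move=> A0; rewrite A0 cards0 in cA wA.
  (* With no middle set, [wA] gives (k + 1)|A| <= kN = (k + 1)M. *)
  have leA : #|A| <= 'C(n, k.+1) by nia.
  have [wB0|wB1] := posnP (waste k B).
    case: (zero_waste nk sB wB0) => [BE|BE|[BE _]].
    - apply: extremalC; left; left; rewrite BE.
      apply: full_layer_extremal => //; first by rewrite -BE; apply: cross_intersectingC.
      by move: sumAB; rewrite BE cN; lia.
    (* A one-sided [B] also has at most M members, but 2M < N + M - 1 because N - M = N/(k + 1) >=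
       2. *)
    - have : #|B :&: layer n k| = 0.
        apply/eqP; rewrite cards_eq0 -subset0; apply/subsetP=> X.
        rewrite BE !inE => /andP[/andP[_ +] /eqP cX].
        by rewrite cX ltnn.
      nia.
    have : #|compls B| = #|above k (compls B)| by rewrite {1}BE.
    rewrite card_compls; nia.
  (* As |A| <= M, |B| >= N - 1. A positive waste uses up the only missing unit k, so each non-middle
     member, costing k + 1 instead of k, would exceed the bound. *)
  have Bl : B \subset layer n k.
    have kw : k <= k * waste k B by rewrite leq_pmulr.
    have kB : k * 'C(n, k) <= k * #|B|.+1 by rewrite leq_mul2l; lia.
    rewrite cB in kB.
    have u0 : #|above k B| + #|above k (compls B)| = 0 by lia.
    by apply/setIidPl/eqP; rewrite eqEcard subsetIl cB -addnA u0 addn0 leqnn.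
  have leB : #|B| <= 'C(n, k) by rewrite -cN subset_leq_card.
  have [b bB] : exists b, b \in B by apply/card_gt0P; nia.
  (* [A] cannot lie below the middle: by the full shadow, [b] would be contained in the complement
     of a member of [A]. *)
  have szA X : X \in A -> k < #|X|.
    case: (zero_waste nk sA wA0) => [AE|-> /above_gt //|[_ QE] _].
      move: cN Nk; rewrite -AE -{1}[A]setIid {2}AE A0 cards0; lia.
    have : b \in layer n k := subsetP Bl _ bB.
    rewrite -QE => /shadowP[_ [Y]]; rewrite !inE => /andP[YA _] bY.
    have := cAB _ _ YA bB.
    by rewrite setIC setI_eq0 disjoints_subset setCK bY.
  have [BN|BN] := eqVneq #|B| 'C(n, k).
    have BE : B = layer n k by apply/eqP; rewrite eqEcard Bl cN BN leqnn.
    right; left; rewrite BE; apply: full_layer_extremal => //; last lia.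
    by rewrite -BE; apply: cross_intersectingC.
  have BN1 : #|B| = 'C(n, k) - 1 by lia.
  have AM : #|A| = 'C(n, k.+1) by lia.
  right; right; split; rewrite kE //.
    by rewrite properEcard Bl cN ltn_neqAle BN.
  apply/eqP; rewrite eqEcard cM AM leqnn andbT.
  by apply: sperner_above_layer => //; rewrite AM.
case: (zero_waste nk sA wA0) => [AE|AE|[AE _]].
- left; left; rewrite AE; apply: full_layer_extremal; rewrite -?AE //.
  by move: sumAB; rewrite AE cN; lia.
- apply: main; apply/setP=> X; rewrite AE !inE.
  by apply/negP=> /andP[/andP[_ kX] /eqP cX]; rewrite cX ltnn in kX.
apply: main; apply/setP=> X; rewrite -[A]complsK AE !inE setCK card_setC_ord.
apply/negP=> /andP[/andP[_ kX] /eqP cX]; lia.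
Qed.

(* The hypotheses and the sum are symmetric in A and B, while (i) and (ii) are
   not; the characterization holds up to exchanging A and B, hence the last two
   disjuncts. *)
Theorem theorem1p6 (n : nat) (A B : {set {set 'I_n}})
    (n_ge4 : 4 <= n) (n_even : ~~ odd n)
    (A_sperner : sperner A) (B_sperner : sperner B)
    (AB_cross : cross_intersecting A B) :
  #|A| + #|B| = 'C(n, n./2) + 'C(n, n./2.+1) - 1 <->
  (extremal_i A B \/ extremal_ii A B) \/ (extremal_i B A \/ extremal_ii B A).
Proof.
have nk : n = n./2.*2 by rewrite even_halfK.
set k := n./2 in nk *; have k1 : 1 < k by lia.
have M0 : 0 < 'C(n, k.+1) by rewrite bin_gt0; lia.
have N0 : 0 < 'C(n, k) by rewrite bin_gt0; lia.
split=> [sumAB|]; last first.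
  case=> [] [[-> _ ->]|[_ -> ->]]; rewrite !card_layer -/k; lia.
have wA := waste_bound nk A_sperner; have cA := card_above A nk.
have wB := waste_bound nk B_sperner; have cB := card_above B nk.
have mid := card_mid_layer_le nk AB_cross.
have NM : k * 'C(n, k) = k.+1 * 'C(n, k.+1).
  by rewrite mul_bin_left; congr (_ * _); lia.
(* Add [wA] and [wB]: at most N members in all are middle sets and cost k, the others cost k + 1, so
   the N + M - 1 members cost at least 2kN - (k + 1). As k >= 2, the total waste is at most 1. *)
have : k * (waste k A + waste k B) <= k.+1 by nia.
have [wA0 _|wA1 le_w] := posnP (waste k A).
  exact: (zero_waste_extremal k1 nk).
have wB0 : waste k B = 0 by nia.
apply: extremalC; apply: (zero_waste_extremal k1 nk) => //.
  exact: cross_intersectingC.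
by rewrite addnC.
Qed.
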